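(* Let $n\ge 1$ be an integer, let $(\rho,\mathbb{C}[x_1,\ldots,x_n])$ be the completely-pointed (oscillator) representation of $\mathfrak{osp}(1|2n)$ and let $(\tau,\mathbb{C}^{1|2n})$ be the natural matrix representation of $\mathfrak{osp}(1|2n)$. The space of singular vectors in the tensor product representation $(\rho\otimes\tau,\ \mathbb{C}[x_1,\ldots,x_n]\otimes\mathbb{C}^{1|2n})$, i.e. the subspace of vectors annihilated by $\mathfrak{n}_+$, is two-dimensional, except when $n=1$, in which case its dimension is three.
   Context: All vector spaces are over $\mathbb{C}$; $|\cdot|$ denotes parity in $\mathbb{Z}/2\mathbb{Z}$. The Lie superalgebra $\mathfrak{g}=\mathfrak{osp}(1|2n)$: let $\mathbb{C}^{1|2n}$ have homogeneous basis $v_0$ (even), $v_1,\ldots,v_{2n}$ (odd). $\mathfrak{g}\subset\mathfrak{gl}(1|2n)$ consists of the block matrices $\begin{bmatrix}0&r\\ c&A\end{bmatrix}$ with $r=(r_1,\ldots,r_{2n})$, $c^{\intercal}=(r_{n+1},\ldots,r_{2n},-r_1,\ldots,-r_n)$, $A\in\mathfrak{sp}(2n)$, with the supercommutator bracket $[X,Y]=XY-(-1)^{|X||Y|}YX$; the block $A$ gives the even part, and $(r,c)$ the odd part. The inclusion is the natural representation $\tau$. Let $\delta_j$ be the $j$-th standard basis vector of $\mathbb{C}^n$ and $E_{ij}$ the $n\times n$ matrix units. Root vectors $X_\beta$ and Cartan elements are (in terms of $\tau$): for $\beta=-\delta_j$: $r=(\delta_j,0)$, $A=0$; for $\beta=\delta_j$: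 $r=(0,\delta_j)$, $A=0$; and with $r=0$: $A=\begin{bmatrix}0&0\\ E_{ij}+E_{ji}&0\end{bmatrix}$ for $\beta=-\delta_i-\delta_j$, $A=\begin{bmatrix}0&0\\ E_{jj}&0\end{bmatrix}$ for $\beta=-2\delta_j$, $A=\begin{bmatrix}0&E_{ij}+E_{ji}\\ 0&0\end{bmatrix}$ for $\beta=\delta_i+\delta_j$, $A=\begin{bmatrix}0&E_{jj}\\ 0&0\end{bmatrix}$ for $\beta=2\delta_j$, $A=\begin{bmatrix}E_{ij}&0\\ 0&-E_{ji}\end{bmatrix}$ for $\beta=\delta_i-\delta_j$ ($i\ne j$); and $H_{2\delta_j}$: $A=\begin{bmatrix}E_{jj}&0\\ 0&-E_{jj}\end{bmatrix}$. The Cartan subalgebra is $\mathfrak{h}=\sum_j\mathbb{C}H_{2\delta_j}$. The representation $\rho$ on $\mathbb{C}[x_1,\ldots,x_n]$ (parity of a monomial = its total degree mod 2) is given by differential operators: $X_{-\delta_i-\delta_j}\mapsto-\partial_i\partial_j$ and $X_{\delta_i+\delta_j}\mapsto x_ix_j$ ($i\neq j$), $X_{-2\delta_j}\mapsto-\tfrac12\partial_j^2$, $X_{2\delta_j}\mapsto\tfrac12x_j^2$, $X_{\delta_i-\delta_j}\mapsto x_i\partial_j$ ($i\ne j$), $X_{-\delta_j}\mapsto\tfrac1{\sqrt2}\partial_j$, $X_{\delta_j}\mapsto\tfrac1{\sqrt2}x_j$, $H_{2\delta_j}\mapsto x_j\partial_j+\tfrac12$, where $\partial_j=\partial/\partial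 x_j$. The tensor product representation is $X(f\otimes v)=\rho(X)f\otimes v+(-1)^{|X||f|}f\otimes\tau(X)v$ for homogeneous $X,f$. Positive roots (for the base $\{-\delta_1,\ \delta_j-\delta_{j+1}: 1\le j<n\}$) are $-\delta_\ell,\ -2\delta_\ell$ ($1\le\ell\le n$) and $\delta_i-\delta_j,\ -\delta_i-\delta_j$ ($1\le i<j\le n$); $\mathfrak{n}_+$ is the span of the corresponding root vectors. A singular vector is a vector $v$ with $ev=0$ for all $e\in\mathfrak{n}_+$. *)

(* Defs.v *)
From HB Require Import structures.
From mathcomp Require Import all_boot all_order all_algebra.
From mathcomp Require Import reals complex mpoly.

Set Implicit Arguments.
Unset Strict Implicit.
Unset Printing Implicit Defensive.

Import Order.TTheory GRing.Theory Num.Theory.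
Local Open Scope ring_scope.

(* The rows and columns of 'M_(1 + (n + n)) are indexed by v_0 (even),
   v_1, ..., v_2n (odd); elements of C^{1|2n} are column vectors. *)

Section Defs.
Context {C : numClosedFieldType} {n : nat}.
Implicit Types (X Y : 'M[C]_(1 + (n + n))) (f g : {mpoly C[n]}).
Implicit Types (v w : 'cV[C]_(1 + (n + n))) (i j l : 'I_n).

Definition mx_part (b : bool) X : 'M[C]_(1 + (n + n)) :=
  if b then block_mx 0 (ursubmx X) (dlsubmx X) 0
  else block_mx (ulsubmx X) 0 0 (drsubmx X).

Definition mx_homog (b : bool) X : Prop := mx_part b X = X.

Definition symplectic (A : 'M[C]_(n + n)) : Prop :=
  let J : 'M[C]_(n + n) := block_mx 0 1%:M (- 1%:M) 0 in
  A^T *m J + J *m A = 0.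

Definition odd_elt (r1 r2 : 'rV[C]_n) : 'M[C]_(1 + (n + n)) :=
  block_mx 0 (row_mx r1 r2) (row_mx r2 (- r1))^T 0.

Definition even_elt (A : 'M[C]_(n + n)) : 'M[C]_(1 + (n + n)) :=
  block_mx 0 0 0 A.

Definition osp X : Prop :=
  exists r1 r2 A, symplectic A /\ X = odd_elt r1 r2 + even_elt A.

(* In these names N stands for a minus sign and d for delta: X_dNd i j is the
   root vector of delta_i - delta_j, X_N2d j that of - 2 delta_j. *)
Definition X_Nd j := odd_elt (delta_mx 0 j) 0.
Definition X_d j := odd_elt 0 (delta_mx 0 j).
Definition X_NdNd i j :=
  even_elt (block_mx 0 0 (delta_mx i j + delta_mx j i) 0).
Definition X_N2d j := even_elt (block_mx 0 0 (delta_mx j j) 0).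
Definition X_dd i j :=
  even_elt (block_mx 0 (delta_mx i j + delta_mx j i) 0 0).
Definition X_2d j := even_elt (block_mx 0 (delta_mx j j) 0 0).
Definition X_dNd i j :=
  even_elt (block_mx (delta_mx i j) 0 0 (- delta_mx j i)).
Definition H_2d j :=
  even_elt (block_mx (delta_mx j j) 0 0 (- delta_mx j j)).

(* On osp, the scalars below are the coordinates of X in the basis formed by
   the root vectors and the H_2d j (see osp_decomp); off osp the value of
   rho X has no meaning. *)
Definition rho X f : {mpoly C[n]} :=
  let r1 := lsubmx (ursubmx X) in
  let r2 := rsubmx (ursubmx X) in
  let a := ulsubmx (drsubmx X) in
  let b := ursubmx (drsubmx X) in
  let c := dlsubmx (drsubmx X) in
  \sum_(j < n) (r1 0 j *: ((sqrtC 2)^-1 *: f^`M(j))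
        + r2 0 j *: ((sqrtC 2)^-1 *: ('X_j * f))
        + c j j *: (- 2^-1 *: f^`M(j)^`M(j))
        + b j j *: (2^-1 *: ('X_j ^+ 2 * f))
        + a j j *: ('X_j * f^`M(j) + 2^-1 *: f))
  + \sum_(i < n) \sum_(j < n | (i < j)%N) (c i j *: (- f^`M(j)^`M(i))
                               + b i j *: ('X_i * 'X_j * f))
  + \sum_(i < n) \sum_(j < n | i != j) a i j *: ('X_i * f^`M(j)).

Definition mpoly_homog (b : bool) f : Prop :=
  forall m, m \in msupp f -> odd (mdeg m) = b.

Definition mpoly_sign f : {mpoly C[n]} :=
  \sum_(m <- msupp f) ((-1) ^+ mdeg m * f@_m) *: 'X_[m].

(* A model of the tensor product of C[x_1, ..., x_n] and C^{1|2n}: the family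
   u stands for the sum over k of (u k) (x) v_k (see tens_universal). *)
Definition tens := {ffun 'I_(1 + (n + n)) -> {mpoly C[n]}}.

Definition pure_tens f v : tens := [ffun k => v k 0 *: f].

(* The operator mpoly_sign carries the sign (-1)^{|X||f|} when X is odd
   (see act_pure_tens). *)
Definition act X (u : tens) : tens :=
  [ffun k => rho X (u k)
    + \sum_l (mx_part false X k l *: u l
            + mx_part true X k l *: mpoly_sign (u l))].

Definition nplus : {vspace 'M[C]_(1 + (n + n))} :=
  (\sum_(l < n) (<[X_Nd l]> + <[X_N2d l]>)
   + \sum_(i < n) \sum_(j < n | (i < j)%N) (<[X_dNd i j]> + <[X_NdNd i j]>))%VS.

Definition singular (u : tens) : Prop :=
  forall e, e \in nplus -> act e u = 0.

End Defs.

Arguments tens : clear implicits.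

Definition has_dim (K : fieldType) (V : lmodType K) (S : V -> Prop) (d : nat) :=
  exists b : 'I_d -> V,
    (forall c : 'I_d -> K, \sum_i c i *: b i = 0 -> forall i, c i = 0)
    /\ (forall u, S u <-> exists c : 'I_d -> K, u = \sum_i c i *: b i).

Section Facts.
Context {C : numClosedFieldType} {n : nat}.
Implicit Types (X Y : 'M[C]_(1 + (n + n))) (f g : {mpoly C[n]}).
Implicit Types (v w : 'cV[C]_(1 + (n + n))) (i j l : 'I_n).

Let linear_comb (U W : lmodType C) (h : U -> W) (I : Type) (r : seq I)
    (c : I -> C) (F : I -> U) : linear h ->
  h (\sum_(i <- r) c i *: F i) = \sum_(i <- r) c i *: h (F i).
Proof.
move=> lh; have h0 : h 0 = 0.
  have := lh 1 0 0; rewrite !scale1r !addr0 => /eqP.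
  by rewrite -subr_eq0 opprD addNKr oppr_eq0 => /eqP.
elim: r => [|k r IH]; first by rewrite !big_nil.
by rewrite !big_cons lh IH.
Qed.

Lemma tens_universal (W : lmodType C)
    (B : {mpoly C[n]} -> 'cV[C]_(1 + (n + n)) -> W) :
  (forall v, linear (B^~ v)) -> (forall f, linear (B f)) ->
  exists h : tens C n -> W,
    [/\ linear h, forall f v, h (pure_tens f v) = B f v
      & forall h', linear h' -> (forall f v, h' (pure_tens f v) = B f v) ->
          h' =1 h].
Proof.
move=> Bl Br; exists (fun u => \sum_k B (u k) (delta_mx k 0)); split.
- move=> a u u'; rewrite scaler_sumr -big_split; apply: eq_bigr => k _ /=.
  by rewrite !ffunE Bl.
- move=> f v.
  have {2}-> : v = \sum_k v k 0 *: delta_mx k 0.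
    by rewrite {1}[v]matrix_sum_delta; apply: eq_bigr => k _; rewrite big_ord1.
  rewrite (linear_comb _ _ _ (Br f)); apply: eq_bigr => k _; rewrite ffunE.
  have := linear_comb [:: tt] (fun=> v k 0) (fun=> f) (Bl (delta_mx k 0)).
  by rewrite !big_seq1.
move=> h' lh' h'E u.
have {1}-> : u = \sum_k 1 *: pure_tens (u k) (delta_mx k 0).
  apply/ffunP => k; rewrite sum_ffunE (bigD1 k) //= big1 => [|l /negPf nlk].
    by rewrite !ffunE mxE !eqxx scale1r addr0 scale1r.
  by rewrite !ffunE mxE eq_sym nlk scale0r scaler0.
rewrite (linear_comb _ _ _ lh'); apply: eq_bigr => k _.
by rewrite scale1r h'E.
Qed.

Lemma symplecticP (A : 'M[C]_(n + n)) :
  symplectic A <->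
  exists a b c : 'M[C]_n,
    [/\ A = block_mx a b c (- a^T), b^T = b & c^T = c].
Proof.
rewrite /symplectic -{1 2}[A]submxK; set a := ulsubmx A; set b := ursubmx A.
set c := dlsubmx A; set d := drsubmx A.
rewrite tr_block_mx !mulmx_block add_block_mx !mulmx0 !mul0mx !mulmxN !mulNmx.
rewrite !mulmx1 !mul1mx !add0r !addr0.
split=> [/eqP|[a' [b' [c' [AE bE cE]]]]]; last first.
  rewrite /a /b /c /d AE block_mxKul block_mxKur block_mxKdl block_mxKdr bE cE.
  by rewrite linearN /= trmxK opprK !(addNr, subrr) block_mx0.
rewrite -block_mx0 => /eqP/eq_block_mx[/eqP + /eqP + _ /eqP].
rewrite addrC subr_eq0 => /eqP cE; rewrite addrC addr_eq0 => /eqP dE.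
rewrite subr_eq0 => /eqP bE; exists a, b, c; split=> //.
by rewrite -dE submxK.
Qed.

Let odd_eltD (r1 r2 s1 s2 : 'rV[C]_n) (k : C) :
  odd_elt (k *: r1 + s1) (k *: r2 + s2) = k *: odd_elt r1 r2 + odd_elt s1 s2.
Proof.
rewrite /odd_elt scale_block_mx add_block_mx !scaler0 !addr0.
rewrite scale_row_mx add_row_mx -linearP /= scale_row_mx add_row_mx.
by rewrite opprD scalerN.
Qed.

Let even_eltD (a b c d a' b' c' d' : 'M[C]_n) (k : C) :
  even_elt (block_mx (k *: a + a') (k *: b + b') (k *: c + c') (k *: d + d'))
  = k *: even_elt (block_mx a b c d) + even_elt (block_mx a' b' c' d').
Proof.
by rewrite /even_elt !scale_block_mx !add_block_mx !scaler0 !addr0.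
Qed.

Let mx_diag_sum (a : 'M[C]_n) (W : lmodType C) (h : 'M[C]_n -> W) : linear h ->
  h a = \sum_(j < n) a j j *: h (delta_mx j j)
      + \sum_(i < n) \sum_(j < n | i != j) a i j *: h (delta_mx i j).
Proof.
move=> lh; rewrite {1}[a]matrix_sum_delta pair_bigA /= (linear_comb _ _ _ lh).
rewrite -(pair_bigA _ (fun i j => a i j *: h (delta_mx i j))) /= -big_split.
apply: eq_bigr => i _ /=; rewrite (bigD1 i) //=; congr (_ + _).
by apply: eq_bigl => j; rewrite eq_sym.
Qed.

Let mx_sym_sum (a : 'M[C]_n) (W : lmodType C) (h : 'M[C]_n -> W) :
    linear h -> a^T = a ->
  h a = \sum_(j < n) a j j *: h (delta_mx j j)
      + \sum_(i < n) \sum_(j < n | (i < j)%N)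
          a i j *: h (delta_mx i j + delta_mx j i).
Proof.
move=> lh aT; have hD x y : h (x + y) = h x + h y.
  by have := lh 1 x y; rewrite !scale1r.
rewrite (mx_diag_sum a lh); congr (_ + _); apply/esym.
under eq_bigr do under eq_bigr do rewrite hD scalerDr.
under eq_bigr do rewrite big_split /=.
rewrite big_split /= addrC (exchange_big_dep xpredT) //= -big_split.
apply: eq_bigr => i _ /=; rewrite [RHS](bigID (fun j => (j < i)%N)) /=.
congr (_ + _).
  apply: eq_big => [j|j _]; first by rewrite -val_eqE neq_ltn; case: ltngtP.
  by rewrite -{1}aT mxE.
by apply: eq_bigl => j; rewrite -val_eqE neq_ltn; case: ltngtP.
Qed.

Lemma osp_decomp X : osp X ->
  let r1 := lsubmx (ursubmx X) in
  let r2 := rsubmx (ursubmx X) in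
  let a := ulsubmx (drsubmx X) in
  let b := ursubmx (drsubmx X) in
  let c := dlsubmx (drsubmx X) in
  X = \sum_(j < n) (r1 0 j *: X_Nd j + r2 0 j *: X_d j
            + c j j *: X_N2d j + b j j *: X_2d j + a j j *: H_2d j)
      + \sum_(i < n) \sum_(j < n | (i < j)%N)
          (c i j *: X_NdNd i j + b i j *: X_dd i j)
      + \sum_(i < n) \sum_(j < n | i != j) a i j *: X_dNd i j.
Proof.
move=> [r1 [r2 [A [/symplecticP[a [b [c [-> bT cT]]]] ->]]]] /=.
rewrite /odd_elt /even_elt add_block_mx !add0r !addr0.
rewrite block_mxKur block_mxKdr row_mxKl row_mxKr.
rewrite block_mxKul block_mxKur block_mxKdl.
have rE (r : 'rV[C]_n) (h : 'rV[C]_n -> 'M[C]_(1 + (n + n))) : linear h ->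
    h r = \sum_(j < n) r 0 j *: h (delta_mx 0 j).
  by move=> lh; rewrite {1}[r]row_sum_delta (linear_comb _ _ _ lh).
pose h1 r := odd_elt r 0 : 'M[C]_(1 + (n + n)).
pose h2 r := odd_elt 0 r : 'M[C]_(1 + (n + n)).
pose ha a := even_elt (block_mx a 0 0 (- a^T)) : 'M[C]_(1 + (n + n)).
pose hb b := even_elt (block_mx 0 b 0 0) : 'M[C]_(1 + (n + n)).
pose hc c := even_elt (block_mx 0 0 c 0) : 'M[C]_(1 + (n + n)).
have l1 : linear h1.
  by move=> k x y; rewrite /h1 -odd_eltD scaler0 addr0.
have l2 : linear h2.
  by move=> k x y; rewrite /h2 -odd_eltD scaler0 addr0.
have la : linear ha.
  by move=> k x y; rewrite /ha -even_eltD !scaler0 !addr0 linearP opprD scalerN.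
have lb : linear hb by move=> k x y; rewrite /hb -even_eltD !scaler0 !addr0.
have lc : linear hc by move=> k x y; rewrite /hc -even_eltD !scaler0 !addr0.
transitivity (h1 r1 + h2 r2 + hc c + hb b + ha a).
  rewrite /h1 /h2 /ha /hb /hc /odd_elt /even_elt !add_block_mx.
  rewrite !(add0r, addr0) -linearD /= !add_row_mx !(add0r, addr0, oppr0).
  by rewrite !add_block_mx !(add0r, addr0).
rewrite (rE _ _ l1) (rE _ _ l2) (mx_sym_sum lb bT) (mx_sym_sum lc cT).
rewrite (mx_diag_sum a la).
have -> : \sum_(j < n) a j j *: ha (delta_mx j j) = \sum_(j < n) a j j *: H_2d j.
  by apply: eq_bigr => j _; rewrite /ha trmx_delta.
have -> : \sum_(i < n) \sum_(j < n | i != j) a i j *: ha (delta_mx i j)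
    = \sum_(i < n) \sum_(j < n | i != j) a i j *: X_dNd i j.
  by apply: eq_bigr => i _; apply: eq_bigr => j _; rewrite /ha trmx_delta.
rewrite !big_split /= addrA; congr (_ + _).
under [X in _ = _ + X]eq_bigr do rewrite big_split /=.
rewrite [X in _ = _ + X]big_split /=.
by rewrite [LHS](AC (2*2*2*1) (1*2*3*5*7*(4*6))).
Qed.

Lemma rho_linear f : linear (rho^~ f).
Proof.
have lin2 (V : lmodType C) (k x1 x2 y1 y2 : C) (F1 F2 : V) :
    (k * x1 + y1) *: F1 + (k * x2 + y2) *: F2
    = k *: (x1 *: F1 + x2 *: F2) + (y1 *: F1 + y2 *: F2).
  by rewrite !scalerDl -!scalerA !scalerDr [LHS](AC (2*2) ((1*3)*(2*4))).
have lin5 (V : lmodType C) (k x1 x2 x3 x4 x5 y1 y2 y3 y4 y5 : C)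
    (F1 F2 F3 F4 F5 : V) :
    (k * x1 + y1) *: F1 + (k * x2 + y2) *: F2 + (k * x3 + y3) *: F3
      + (k * x4 + y4) *: F4 + (k * x5 + y5) *: F5
    = k *: (x1 *: F1 + x2 *: F2 + x3 *: F3 + x4 *: F4 + x5 *: F5)
      + (y1 *: F1 + y2 *: F2 + y3 *: F3 + y4 *: F4 + y5 *: F5).
  by rewrite !scalerDl -!scalerA !scalerDr
       [LHS](AC (2*2*2*2*2) ((1*3*5*7*9)*(2*4*6*8*10))).
move=> k X Y; rewrite /rho /= [k *: (_ + _)]scalerDr [k *: (_ + _)]scalerDr.
rewrite [RHS](AC (3*3) (1*4*(2*5)*(3*6))); congr (_ + _ + _).
- rewrite scaler_sumr -big_split; apply: eq_bigr => j _ /=.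
  by rewrite -lin5 !mxE.
- rewrite scaler_sumr -big_split; apply: eq_bigr => i _ /=.
  rewrite scaler_sumr -big_split; apply: eq_bigr => j _ /=.
  by rewrite -lin2 !mxE.
rewrite scaler_sumr -big_split; apply: eq_bigr => i _ /=.
rewrite scaler_sumr -big_split; apply: eq_bigr => j _ /=.
by rewrite !mxE scalerDl scalerA.
Qed.

Let rho_odd (r1 r2 : 'rV[C]_n) f : rho (odd_elt r1 r2) f =
  \sum_(j < n) (r1 0 j *: ((sqrtC 2)^-1 *: f^`M(j))
              + r2 0 j *: ((sqrtC 2)^-1 *: ('X_j * f))).
Proof.
rewrite /rho /odd_elt block_mxKur block_mxKdr row_mxKl row_mxKr.
rewrite [X in _ + X + _]big1 => [|i _]; last first.
  by apply: big1 => j _; rewrite !mxE !scale0r addr0.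
rewrite [X in _ + X]big1 => [|i _]; last first.
  by apply: big1 => j _; rewrite !mxE !scale0r.
rewrite !addr0; apply: eq_bigr => j _.
by rewrite !mxE !scale0r !addr0.
Qed.

Let rho_even (a b c d : 'M[C]_n) f : rho (even_elt (block_mx a b c d)) f =
  \sum_(j < n) (c j j *: (- 2^-1 *: f^`M(j)^`M(j))
        + b j j *: (2^-1 *: ('X_j ^+ 2 * f))
        + a j j *: ('X_j * f^`M(j) + 2^-1 *: f))
  + \sum_(i < n) \sum_(j < n | (i < j)%N) (c i j *: (- f^`M(j)^`M(i))
                               + b i j *: ('X_i * 'X_j * f))
  + \sum_(i < n) \sum_(j < n | i != j) a i j *: ('X_i * f^`M(j)).
Proof.
rewrite /rho /even_elt block_mxKur block_mxKdr.
rewrite block_mxKul block_mxKur block_mxKdl; congr (_ + _ + _).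
by apply: eq_bigr => j _; rewrite !mxE !scale0r !add0r.
Qed.

Let sum_delta (k : 'I_n) (P : pred 'I_n) (V : nmodType) (F : 'I_n -> V) :
  P k -> (forall i, P i -> i != k -> F i = 0) -> \sum_(i < n | P i) F i = F k.
Proof.
by move=> Pk F0; rewrite (bigD1 k) //= big1 ?addr0 // => i /andP[]; apply: F0.
Qed.

Lemma rho_Nd j f : rho (X_Nd j) f = (sqrtC 2)^-1 *: f^`M(j).
Proof.
rewrite rho_odd (@sum_delta j) // => [|i _ /negPf nij].
  by rewrite !mxE !eqxx scale1r scale0r addr0.
by rewrite !mxE nij !scale0r addr0.
Qed.

Lemma rho_d j f : rho (X_d j) f = (sqrtC 2)^-1 *: ('X_j * f).
Proof.
rewrite rho_odd (@sum_delta j) // => [|i _ /negPf nij].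
  by rewrite !mxE !eqxx scale1r scale0r add0r.
by rewrite !mxE nij !scale0r addr0.
Qed.

Lemma rho_N2d j f : rho (X_N2d j) f = - 2^-1 *: f^`M(j)^`M(j).
Proof.
rewrite rho_even [X in _ + X + _]big1 => [|i _]; last first.
  apply: big1 => l il; rewrite !mxE.
  have -> : (i == j) && (l == j) = false.
    by apply/andP=> -[/eqP ij /eqP lj]; rewrite ij lj ltnn in il.
  by rewrite !scale0r addr0.
rewrite [X in _ + X]big1 => [|i _]; last first.
  by apply: big1 => l il; rewrite !mxE scale0r.
rewrite (@sum_delta j) // => [|i _ /negPf nij].
  by rewrite !mxE !eqxx !scale0r !addr0 scale1r.
by rewrite !mxE nij !scale0r !addr0.
Qed.

Lemma rho_2d j f : rho (X_2d j) f = 2^-1 *: ('X_j ^+ 2 * f).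
Proof.
rewrite rho_even [X in _ + X + _]big1 => [|i _]; last first.
  apply: big1 => l il; rewrite !mxE.
  have -> : (i == j) && (l == j) = false.
    by apply/andP=> -[/eqP ij /eqP lj]; rewrite ij lj ltnn in il.
  by rewrite !scale0r addr0.
rewrite [X in _ + X]big1 => [|i _]; last first.
  by apply: big1 => l il; rewrite !mxE scale0r.
rewrite (@sum_delta j) // => [|i _ /negPf nij].
  by rewrite !mxE !eqxx !scale0r !addr0 add0r scale1r.
by rewrite !mxE nij !scale0r !addr0.
Qed.

Lemma rho_H_2d j f : rho (H_2d j) f = 'X_j * f^`M(j) + 2^-1 *: f.
Proof.
rewrite rho_even [X in _ + X + _]big1 => [|i _]; last first.
  by apply: big1 => l il; rewrite !mxE !scale0r addr0.
rewrite [X in _ + X]big1 => [|i _]; last first.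
  apply: big1 => l il; rewrite !mxE.
  have -> : (i == j) && (l == j) = false.
    by apply/andP=> -[/eqP ij /eqP lj]; rewrite ij lj eqxx in il.
  by rewrite scale0r.
rewrite (@sum_delta j) // => [|i _ /negPf nij].
  by rewrite !mxE !eqxx !scale0r !addr0 add0r scale1r.
by rewrite !mxE nij !scale0r !addr0.
Qed.

Lemma rho_dNd i j f : i != j -> rho (X_dNd i j) f = 'X_i * f^`M(j).
Proof.
move=> nij; rewrite rho_even [X in X + _ + _]big1 => [|k _]; last first.
  rewrite !mxE; have -> : (k == i) && (k == j) = false.
    by apply/andP=> -[/eqP ki /eqP kj]; rewrite -ki -kj eqxx in nij.
  by rewrite !scale0r !addr0.
rewrite [X in _ + X + _]big1 => [|k _]; last first.
  by apply: big1 => l il; rewrite !mxE !scale0r addr0.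
rewrite !add0r (@sum_delta i) // => [|k _ /negPf nki]; last first.
  by apply: big1 => l _; rewrite mxE nki scale0r.
rewrite (@sum_delta j) // => [|l _ /negPf nlj]; last first.
  by rewrite mxE nlj andbF scale0r.
by rewrite mxE !eqxx scale1r.
Qed.

Let sum_sym (V : lmodType C) (F : 'I_n -> 'I_n -> V) i j : (i < j)%N ->
  \sum_(k < n) \sum_(l < n | (k < l)%N)
    (delta_mx i j + delta_mx j i : 'M[C]_n) k l *: F k l = F i j.
Proof.
move=> ij; have nE (k l : 'I_n) : (k < l)%N ->
    (delta_mx i j + delta_mx j i : 'M[C]_n) k l = ((k == i) && (l == j))%:R.
  move=> kl; rewrite !mxE.
  have -> : (k == j) && (l == i) = false.
    apply/andP=> -[/eqP ki /eqP lj].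
    by rewrite ki lj ltnNge (ltnW ij) in kl.
  by rewrite addr0.
rewrite (@sum_delta i) // => [|k _ /negPf nki]; last first.
  by apply: big1 => l kl; rewrite nE // nki scale0r.
rewrite (@sum_delta j) // => [|l il /negPf nlj]; last first.
  by rewrite nE // nlj andbF scale0r.
by rewrite nE // !eqxx scale1r.
Qed.

Lemma rho_NdNd i j f : i != j -> rho (X_NdNd i j) f = - f^`M(j)^`M(i).
Proof.
wlog ij : i j / (i < j)%N => [IH nij|nij].
  have := nij; rewrite -val_eqE neq_ltn => /orP[ij|ji]; first exact: IH.
  rewrite mderiv_comm /X_NdNd [delta_mx i j + _]addrC.
  by apply: IH => //; rewrite eq_sym.
rewrite rho_even [X in X + _ + _]big1 => [|k _]; last first.
  rewrite !mxE; have -> : (k == i) && (k == j) = false.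
    by apply/andP=> -[/eqP ki /eqP kj]; rewrite -ki -kj eqxx in nij.
  rewrite andbC; have -> : (k == i) && (k == j) = false.
    by apply/andP=> -[/eqP ki /eqP kj]; rewrite -ki -kj eqxx in nij.
  by rewrite addr0 !scale0r !addr0.
rewrite [X in _ + X]big1 => [|k _]; last first.
  by apply: big1 => l _; rewrite mxE scale0r.
rewrite add0r addr0 -[RHS](@sum_sym _ (fun k l => - f^`M(l)^`M(k)) i j ij).
apply: eq_bigr => k _; apply: eq_bigr => l _.
by rewrite [(0 : 'M_n) _ _]mxE scale0r addr0.
Qed.

Lemma rho_dd i j f : i != j -> rho (X_dd i j) f = 'X_i * 'X_j * f.
Proof.
wlog ij : i j / (i < j)%N => [IH nij|nij].
  have := nij; rewrite -val_eqE neq_ltn => /orP[ij|ji]; first exact: IH.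
  rewrite ['X_i * _]mulrC /X_dd [delta_mx i j + _]addrC.
  by apply: IH => //; rewrite eq_sym.
rewrite rho_even [X in X + _ + _]big1 => [|k _]; last first.
  rewrite !mxE; have -> : (k == i) && (k == j) = false.
    by apply/andP=> -[/eqP ki /eqP kj]; rewrite -ki -kj eqxx in nij.
  rewrite andbC; have -> : (k == i) && (k == j) = false.
    by apply/andP=> -[/eqP ki /eqP kj]; rewrite -ki -kj eqxx in nij.
  by rewrite addr0 !scale0r !addr0.
rewrite [X in _ + X]big1 => [|k _]; last first.
  by apply: big1 => l _; rewrite mxE scale0r.
rewrite add0r addr0 -[RHS](@sum_sym _ (fun k l => 'X_k * 'X_l * f) i j ij).
apply: eq_bigr => k _; apply: eq_bigr => l _.
by rewrite [(0 : 'M_n) _ _]mxE scale0r add0r.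
Qed.

Lemma act_pure_tens (a b : bool) X f v : mx_homog a X -> mpoly_homog b f ->
  act X (pure_tens f v)
  = pure_tens (rho X f) v + (-1) ^+ (a && b) *: pure_tens f (X *m v).
Proof.
move=> hX hf; have sf k : mpoly_sign (k *: f) = (-1) ^+ b *: (k *: f).
  have hkf : mpoly_homog b (k *: f).
    by move=> m /msuppZ_le; apply: hf.
  rewrite /mpoly_sign [in RHS](mpolyE (k *: f)) scaler_sumr.
  rewrite big_seq [RHS]big_seq; apply: eq_bigr => m mf.
  by rewrite scalerA -signr_odd (hkf _ mf).
have rZ k : rho X (k *: f) = k *: rho X f.
  have cA (x : C) (g : {mpoly C[n]}) : x *: (k *: g) = k *: (x *: g).
    by rewrite !scalerA mulrC.
  rewrite /rho [RHS]scalerDr [in RHS]scalerDr; congr (_ + _ + _).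
  - rewrite scaler_sumr; apply: eq_bigr => j _.
    rewrite [RHS]scalerDr; congr (_ + _); last first.
      by rewrite mderivZ -scalerAr (cA 2^-1) -scalerDr cA.
    rewrite [RHS]scalerDr; congr (_ + _); last first.
      by rewrite -scalerAr (cA 2^-1) cA.
    rewrite [RHS]scalerDr; congr (_ + _); last first.
      by rewrite !mderivZ (cA (- 2^-1)) cA.
    rewrite [RHS]scalerDr; congr (_ + _); last first.
      by rewrite -scalerAr (cA (sqrtC 2)^-1) cA.
    by rewrite mderivZ (cA (sqrtC 2)^-1) cA.
  - rewrite scaler_sumr; apply: eq_bigr => i _.
    rewrite scaler_sumr; apply: eq_bigr => j _.
    rewrite [RHS]scalerDr !mderivZ -scalerAr -scalerN; congr (_ + _); exact: cA.
  rewrite scaler_sumr; apply: eq_bigr => i _.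
  rewrite scaler_sumr; apply: eq_bigr => j _.
  by rewrite mderivZ -scalerAr cA.
apply/ffunP => k; rewrite !ffunE rZ; congr (_ + _).
rewrite mxE scalerA mulr_sumr scaler_suml; apply: eq_bigr => l _.
rewrite !ffunE sf.
have X0 : mx_part (~~ a) X = 0.
  rewrite -hX; case: (a); rewrite /= ?block_mxKul ?block_mxKur ?block_mxKdl;
  by rewrite ?block_mxKdr block_mx0.
case: a hX X0 => /= hX X0; rewrite -[in RHS]hX /=; rewrite X0 [(0 : 'M[C]_(1 + (n + n))) k l]mxE scale0r.
  by rewrite add0r !scalerA mulrCA mulrA.
by rewrite addr0 expr0 mul1r scalerA.
Qed.

End Facts.

(* Main.v *)
Require Import Defs.
From mathcomp Require Import all_boot all_order all_algebra.
From mathcomp Require Import reals complex mpoly.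

(* Write u in components: an even u_0 and p_k, q_k for the two halves of the odd
   basis; s is the parity sign. The operators of -delta_j and of
   delta_i - delta_j alone cut out the singular vectors: they say that
   d_j u_0 = - sqrt 2 s(p_j), d_j p_k = 0, d_j q_k = [k = j] sqrt 2 s(u_0), and,
   for i < j, that p_j = 0 and q_i = sqrt 2 x_i s(u_0). Hence p_1 = c and
   u_0 = a - sqrt 2 c x_1, all q_k except the last are determined, and the last
   one is determined up to a constant d. If n > 1, then
   0 = d_n d_1 q_n = d_1 d_n q_n = 2 c, so that only a and d are free; if n = 1,
   nothing constrains c. *)

Set Implicit Arguments.
Unset Strict Implicit.
Unset Printing Implicit Defensive.

Import GRing.Theory Num.Theory.
Local Open Scope ring_scope.

(** * The parity sign on polynomials, and partial derivatives *)

Section Sign.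
Context {C : numClosedFieldType} {n : nat}.
Implicit Types (f g : {mpoly C[n]}) (j k : 'I_n) (m : 'X_{1..n}).

(** Replaces the sum over the support by a formula valid at every monomial, so that the identities
    below can be checked coefficientwise. *)
Lemma mcoeff_sign f m : (mpoly_sign f)@_m = (-1) ^+ mdeg m * f@_m.
Proof.
rewrite /mpoly_sign raddf_sum /=.
under eq_bigr do rewrite mcoeffZ mcoeffX.
have [mf|mf] := boolP (m \in msupp f).
  rewrite (bigD1_seq m) //= ?msupp_uniq // eqxx mulr1 big1 ?addr0 //.
  by move=> i /negPf->; rewrite mulr0.
rewrite (memN_msupp_eq0 mf) mulr0 big_seq big1 // => i fi.
by case: eqP => [im|]; rewrite ?mulr0 //; rewrite -im fi in mf.
Qed.

Lemma mpoly_signD f g : mpoly_sign (f + g) = mpoly_sign f + mpoly_sign g.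
Proof. by apply/mpolyP => m; rewrite !(mcoeffD, mcoeff_sign) mulrDr. Qed.

Lemma mpoly_signZ (k : C) f : mpoly_sign (k *: f) = k *: mpoly_sign f.
Proof. by apply/mpolyP => m; rewrite !(mcoeffZ, mcoeff_sign) mulrCA. Qed.

Lemma mpoly_sign0 : mpoly_sign (0 : {mpoly C[n]}) = 0.
Proof. by have := mpoly_signZ 0 0; rewrite !scale0r. Qed.

Lemma mpoly_signX m :
  mpoly_sign 'X_[C, m] = (-1) ^+ mdeg m *: 'X_[m].
Proof.
apply/mpolyP => m'; rewrite mcoeff_sign mcoeffZ mcoeffX.
by case: eqP => [->|]; rewrite ?mulr0.
Qed.

Lemma mpoly_signN f : mpoly_sign (- f) = - mpoly_sign f.
Proof. by rewrite -scaleN1r mpoly_signZ scaleN1r. Qed.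

Lemma mpoly_sign1 : mpoly_sign (1 : {mpoly C[n]}) = 1.
Proof. by rewrite -mpolyX0 mpoly_signX mdeg0 expr0 scale1r. Qed.

Lemma mpoly_signK : involutive (@mpoly_sign C n).
Proof.
by move=> f; apply/mpolyP => m; rewrite !mcoeff_sign mulrA -expr2 sqrr_sign
  mul1r.
Qed.

(** A derivative lowers the degree of every monomial by one, which flips the parity sign. *)
Lemma mderiv_sign j f : (mpoly_sign f)^`M(j) = - mpoly_sign f^`M(j).
Proof.
apply/mpolyP => m; rewrite mcoeffN mcoeff_sign !mcoeff_mderiv mcoeff_sign.
by rewrite mdegD mdeg1 addn1 exprS mulN1r mulNr mulNrn mulrnAr.
Qed.

(** In characteristic zero a coefficient at a monomial containing $x_j$ survives in the derivative
    along $j$, multiplied by a positive integer. This is how the differential system is integrated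
    later. *)
Lemma mpoly_const f : (forall j, f^`M(j) = 0) -> f = f@_0%MM *: 1.
Proof.
move=> df; apply/mpolyP => m; rewrite mcoeffZ mcoeff1.
have [->|nm] := eqVneq m 0%MM; first by rewrite mulr1.
rewrite mulr0.
have [j mj] : exists j, m j != 0%N.
  apply/existsP; apply: contraR nm; rewrite negb_exists => /forallP m0.
  by apply/eqP/mnmP => j; rewrite mnm0E; apply/eqP; rewrite -[_ == _]negbK.
(* Subtraction of multi-indices is truncated; since [m j] is nonzero, adding [U_(j)] back gives
   [m]. *)
have := congr1 (mcoeff (m - U_(j))%MM) (df j).
rewrite mcoeff_mderiv submK; last by rewrite lep1mP.
by rewrite mcoeff0 => /eqP; rewrite mulrn_eq0 => /eqP.
Qed.

Lemma mderivXU j k : ('X_k : {mpoly C[n]})^`M(j) = (k == j)%:R *: 1.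
Proof.
rewrite mderivX mnm1E; case: eqP => [->|_]; last by rewrite !scale0r.
by rewrite -mpolyX0; congr (_ *: 'X_[_]); apply/mnmP => i;
  rewrite mnmBE subnn mnm0E.
Qed.

Lemma mpoly_signXU j : mpoly_sign ('X_j : {mpoly C[n]}) = - 'X_j.
Proof. by rewrite mpoly_signX mdeg1 expr1 scaleN1r. Qed.

End Sign.

(** * The action in components, and the equations of singular vectors *)

Section Act.
Context {C : numClosedFieldType} {n : nat}.
Implicit Types (X Y : 'M[C]_(1 + (n + n))) (u : tens C n) (i j k l : 'I_n).

(** The three kinds of positions are those of $v_0$, of $v_1,\ldots,v_n$ and of
    $v_{n+1},\ldots,v_{2n}$; the components of [u] there are $u_0$, $p_k$ and $q_k$. *)
Definition even_pos : 'I_(1 + (n + n)) := lshift (n + n) ord0.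
Definition left_pos k : 'I_(1 + (n + n)) := rshift 1 (lshift n k).
Definition right_pos k : 'I_(1 + (n + n)) := rshift 1 (rshift n k).

Lemma posP (P : 'I_(1 + (n + n)) -> Prop) :
  P even_pos -> (forall k, P (left_pos k)) -> (forall k, P (right_pos k)) ->
  forall h, P h.
Proof.
move=> P0 Pl Pr h; rewrite -(splitK h); case: (split h) => [o|h'] /=.
  by rewrite ord1.
by rewrite -(splitK h'); case: (split h') => k; [apply: Pl|apply: Pr].
Qed.

Lemma big_pos (V : nmodType) (F : 'I_(1 + (n + n)) -> V) :
  \sum_h F h = F even_pos + \sum_k F (left_pos k) + \sum_k F (right_pos k).
Proof. by rewrite big_split_ord big_ord1 big_split_ord /= addrA. Qed.

(** Needed to pass from the root vectors to all of $\mathfrak{n}_+$: both [rho] and the two parity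
    parts of a matrix are linear in the matrix. *)
Lemma act_linearl u : linear (@act C n ^~ u).
Proof.
move=> a X Y; apply/ffunP => h; rewrite !ffunE rho_linear [in RHS]scalerDr.
rewrite [RHS]addrACA; congr (_ + _).
rewrite scaler_sumr -big_split; apply: eq_bigr => l _.
have mxpE b : mx_part b (a *: X + Y) = a *: mx_part b X + mx_part b Y.
  by case: b; rewrite /= scale_block_mx add_block_mx !scaler0 !addr0;
      congr block_mx; apply/matrixP => x y; rewrite !mxE.
by rewrite !mxpE !mxE /= !scalerDl !scalerDr -!scalerA addrACA.
Qed.

(** An odd element equals its odd part, so each matrix entry comes with the parity sign. The lower
    left block $(r_2,-r_1)^{\intercal}$ accounts for [r2] in the left positions and for the minus
    sign in the right ones. *)
Lemma act_odd_eltE (r1 r2 : 'rV[C]_n) u :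
  [/\ act (odd_elt r1 r2) u even_pos = rho (odd_elt r1 r2) (u even_pos)
        + \sum_l (r1 0 l *: mpoly_sign (u (left_pos l))
                  + r2 0 l *: mpoly_sign (u (right_pos l))),
      forall k, act (odd_elt r1 r2) u (left_pos k)
        = rho (odd_elt r1 r2) (u (left_pos k))
          + r2 0 k *: mpoly_sign (u even_pos)
    & forall k, act (odd_elt r1 r2) u (right_pos k)
        = rho (odd_elt r1 r2) (u (right_pos k))
          - r1 0 k *: mpoly_sign (u even_pos)].
Proof.
have p0 : mx_part false (odd_elt r1 r2) = 0.
  by rewrite /= /odd_elt block_mxKul block_mxKdr block_mx0.
have p1 : mx_part true (odd_elt r1 r2) = odd_elt r1 r2.
  by rewrite /= /odd_elt block_mxKur block_mxKdl.
split=> [|k|k]; rewrite ffunE p0 p1 big_pos /odd_elt; congr (_ + _).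
- rewrite block_mxEul !mxE !scale0r !add0r -big_split; apply: eq_bigr => l _ /=.
  by rewrite block_mxEur row_mxEl block_mxEur row_mxEr !mxE !scale0r !add0r.
- rewrite !big1 ?addr0 => [|l _|l _]; last 2 first.
  + by rewrite block_mxEdr !mxE !scale0r addr0.
  + by rewrite block_mxEdr !mxE !scale0r addr0.
  by rewrite block_mxEdl mxE [_^T _ _]mxE row_mxEl scale0r add0r.
rewrite !big1 ?addr0 => [|l _|l _]; last 2 first.
- by rewrite block_mxEdr !mxE !scale0r addr0.
- by rewrite block_mxEdr !mxE !scale0r addr0.
by rewrite block_mxEdl mxE [_^T _ _]mxE row_mxEr mxE scale0r add0r scaleNr.
Qed.

Lemma act_even_eltE (a b c d : 'M[C]_n) u :
  let X := even_elt (block_mx a b c d) in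
  [/\ act X u even_pos = rho X (u even_pos),
      forall k, act X u (left_pos k) = rho X (u (left_pos k))
        + \sum_l (a k l *: u (left_pos l) + b k l *: u (right_pos l))
    & forall k, act X u (right_pos k) = rho X (u (right_pos k))
        + \sum_l (c k l *: u (left_pos l) + d k l *: u (right_pos l))].
Proof.
move=> X.
have p0 : mx_part false X = X.
  by rewrite /= /X /even_elt block_mxKul block_mxKdr.
have p1 : mx_part true X = 0.
  by rewrite /= /X /even_elt block_mxKur block_mxKdl block_mx0.
split=> [|k|k]; rewrite ffunE p0 p1 big_pos /X /even_elt.
- rewrite block_mxEul !mxE !scale0r !add0r !big1 ?addr0 // => l _.
  + by rewrite block_mxEur !mxE !scale0r addr0.
  by rewrite block_mxEur !mxE !scale0r addr0.
- rewrite block_mxEdl !mxE !scale0r !add0r -big_split; congr (_ + _).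
  apply: eq_bigr => l _ /=; rewrite !block_mxEdr block_mxEul block_mxEur.
  by rewrite !mxE !scale0r !addr0.
rewrite block_mxEdl !mxE !scale0r !add0r -big_split; congr (_ + _).
apply: eq_bigr => l _ /=; rewrite !block_mxEdr block_mxEdl.
by rewrite !mxE !scale0r !addr0.
Qed.

(** As a sum of lines, $\mathfrak{n}_+$ is covered by linear combinations of its root vectors, so a
    property stable under these need only be checked on the four families. *)
Lemma nplus_ind (P : 'M[C]_(1 + (n + n)) -> Prop) :
  P 0 -> (forall a X Y, P X -> P Y -> P (a *: X + Y)) ->
  (forall j, P (X_Nd j)) -> (forall j, P (X_N2d j)) ->
  (forall i j, (i < j)%N -> P (X_dNd i j)) ->
  (forall i j, (i < j)%N -> P (X_NdNd i j)) ->
  forall e, e \in nplus -> P e.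
Proof.
move=> P0 PL P1 P2 P3 P4.
have PD X Y : P X -> P Y -> P (X + Y) by rewrite -{2}(scale1r X); apply: PL.
have Pline X e : P X -> e \in <[X]>%VS -> P e.
  by move=> PX /vlineP[a ->]; rewrite -[_ *: _]addr0; apply: PL.
have Padd (U V : {vspace 'M[C]_(1 + (n + n))}) e :
    (forall e', e' \in U -> P e') -> (forall e', e' \in V -> P e') ->
    e \in (U + V)%VS -> P e.
  by move=> PU PV /memv_addP[x xU [y yV ->]]; apply: PD; [apply: PU|apply: PV].
have Psum (Q : pred 'I_n) (U : 'I_n -> {vspace 'M[C]_(1 + (n + n))}) e :
    (forall i e', Q i -> e' \in U i -> P e') ->
    e \in (\sum_(i | Q i) U i)%VS -> P e.
  move=> PU /memv_sumP[w wU ->]; elim/big_ind: _ => // i Qi.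
  by apply: (PU i) => //; apply: wU.
move=> e; apply: (Padd) => e'.
  by apply: (Psum) => l x _; apply: (Padd) => y; apply: Pline.
apply: (Psum) => i x _; apply: (Psum) => j y ij.
by apply: (Padd) => z; apply: (Pline); auto.
Qed.

Lemma nplus_gens :
  [/\ forall j, X_Nd j \in @nplus C n, forall j, X_N2d j \in @nplus C n,
      forall i j, (i < j)%N -> X_dNd i j \in @nplus C n
    & forall i j, (i < j)%N -> X_NdNd i j \in @nplus C n].
Proof.
rewrite /nplus; split=> [j|j|i j ij|i j ij].
- apply: (subvP (addvSl _ _)); apply: (subvP (sumv_sup j _ (subvv _))) => //.
  exact: (subvP (addvSl _ _)) (memv_line _).
- apply: (subvP (addvSl _ _)); apply: (subvP (sumv_sup j _ (subvv _))) => //.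
  exact: (subvP (addvSr _ _)) (memv_line _).
- apply: (subvP (addvSr _ _)); apply: (subvP (sumv_sup i _ (subvv _))) => //.
  apply: (subvP (sumv_sup j ij (subvv _))).
  exact: (subvP (addvSl _ _)) (memv_line _).
apply: (subvP (addvSr _ _)); apply: (subvP (sumv_sup i _ (subvv _))) => //.
apply: (subvP (sumv_sup j ij (subvv _))).
exact: (subvP (addvSr _ _)) (memv_line _).
Qed.

(** The number of rows [p] is left free so that the formula serves both the row vectors of odd
    elements and the square blocks of even ones. *)
Lemma sum_delta_mx (V : lmodType C) p (i k : 'I_p) j (F : 'I_n -> V) :
  \sum_l (delta_mx i j) k l *: F l = (k == i)%:R *: F j.
Proof.
rewrite (bigD1 j) //= big1 => [|l /negPf lj];
  last by rewrite mxE lj andbF scale0r.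
by rewrite mxE eqxx andbT addr0.
Qed.

(** * The four families of positive root vectors in components *)

Lemma act_X_NdE j u :
  [/\ act (X_Nd j) u even_pos
        = (sqrtC 2)^-1 *: (u even_pos)^`M(j) + mpoly_sign (u (left_pos j)),
      forall k, act (X_Nd j) u (left_pos k)
        = (sqrtC 2)^-1 *: (u (left_pos k))^`M(j)
    & forall k, act (X_Nd j) u (right_pos k)
        = (sqrtC 2)^-1 *: (u (right_pos k))^`M(j)
          - (k == j)%:R *: mpoly_sign (u even_pos)].
Proof.
have [E0 El Er] := act_odd_eltE (delta_mx 0 j) 0 u; split=> [|k|k].
- rewrite E0 -/(X_Nd j) rho_Nd big_split /= sum_delta_mx eqxx scale1r big1
    ?addr0 //.
  by move=> l _; rewrite mxE scale0r.
- by rewrite El -/(X_Nd j) rho_Nd mxE scale0r addr0.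
by rewrite Er -/(X_Nd j) rho_Nd mxE.
Qed.

Lemma act_X_N2dE j u :
  [/\ act (X_N2d j) u even_pos = - 2^-1 *: (u even_pos)^`M(j)^`M(j),
      forall k, act (X_N2d j) u (left_pos k)
        = - 2^-1 *: (u (left_pos k))^`M(j)^`M(j)
    & forall k, act (X_N2d j) u (right_pos k)
        = - 2^-1 *: (u (right_pos k))^`M(j)^`M(j)
          + (k == j)%:R *: u (left_pos j)].
Proof.
have [E0 El Er] := act_even_eltE 0 0 (delta_mx j j) 0 u; split=> [|k|k].
- by rewrite E0 rho_N2d.
- rewrite El -/(X_N2d j) rho_N2d big1 ?addr0 // => l _.
  by rewrite !mxE !scale0r addr0.
rewrite Er -/(X_N2d j) rho_N2d big_split /= sum_delta_mx [X in _ + (_ + X)]big1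
  ?addr0 //.
by move=> l _; rewrite mxE scale0r.
Qed.

Lemma act_X_dNdE i j u : i != j ->
  [/\ act (X_dNd i j) u even_pos = 'X_i * (u even_pos)^`M(j),
      forall k, act (X_dNd i j) u (left_pos k)
        = 'X_i * (u (left_pos k))^`M(j) + (k == i)%:R *: u (left_pos j)
    & forall k, act (X_dNd i j) u (right_pos k)
        = 'X_i * (u (right_pos k))^`M(j) - (k == j)%:R *: u (right_pos i)].
Proof.
move=> nij; have [E0 El Er] := act_even_eltE (delta_mx i j) 0 0 (- delta_mx j i)
  u.
split=> [|k|k].
- by rewrite E0 rho_dNd.
- rewrite El -/(X_dNd i j) rho_dNd // big_split /= sum_delta_mx.
  by rewrite [X in _ + (_ + X)]big1 ?addr0 // => l _; rewrite mxE scale0r.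
rewrite Er -/(X_dNd i j) rho_dNd // big_split /= big1 => [|l _]; last first.
  by rewrite mxE scale0r.
rewrite add0r -(sum_delta_mx j k i (fun l => u (right_pos l))) -sumrN;
  congr (_ + _); apply: eq_bigr => l _.
by rewrite -scaleNr !mxE.
Qed.

Lemma act_X_NdNdE i j u : i != j ->
  [/\ act (X_NdNd i j) u even_pos = - (u even_pos)^`M(j)^`M(i),
      forall k, act (X_NdNd i j) u (left_pos k)
        = - (u (left_pos k))^`M(j)^`M(i)
    & forall k, act (X_NdNd i j) u (right_pos k)
        = - (u (right_pos k))^`M(j)^`M(i)
          + ((k == i)%:R *: u (left_pos j) + (k == j)%:R *: u (left_pos i))].
Proof.
move=> nij; have [E0 El Er] := act_even_eltE 0 0 (delta_mx i j + delta_mx j i) 0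
  u.
split=> [|k|k].
- by rewrite E0 rho_NdNd.
- rewrite El -/(X_NdNd i j) rho_NdNd // big1 ?addr0 // => l _.
  by rewrite !mxE !scale0r addr0.
rewrite Er -/(X_NdNd i j) rho_NdNd //; congr (_ + _).
rewrite -!(sum_delta_mx _ _ _ (fun l => u (left_pos l))) -big_split;
  apply: eq_bigr => l _ /=.
by rewrite -scalerDl [X in _ + X *: _]mxE scale0r addr0 mxE.
Qed.

(** The equations come from the roots $-\delta_j$ and $\delta_i-\delta_j$. Conversely, they
    determine the second derivatives of every component, and these are what the remaining roots
    $-2\delta_j$ and $-\delta_i-\delta_j$ require. *)
Lemma singularP u :
  singular u <->
  [/\ forall j, (u even_pos)^`M(j) = - (sqrtC 2 *: mpoly_sign (u (left_pos j))),
      forall j k, (u (left_pos k))^`M(j) = 0,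
      forall j k, (u (right_pos k))^`M(j)
        = (k == j)%:R *: (sqrtC 2 *: mpoly_sign (u even_pos))
    & forall i j, (i < j)%N -> u (left_pos j) = 0
        /\ u (right_pos i) = sqrtC 2 *: ('X_i * mpoly_sign (u even_pos))].
Proof.
have r0 : sqrtC 2 != 0 :> C by rewrite sqrtC_eq0 pnatr_eq0.
have rr : sqrtC 2 * sqrtC 2 = 2 :> C by rewrite -expr2 sqrtCK.
have ltn_neq i j : (i < j)%N -> i != j by rewrite -val_eqE neq_ltn => ->.
have half2 : 2^-1 * 2 = 1 :> C by rewrite mulVf // pnatr_eq0.
have [gNd gN2d gdNd gNdNd] := nplus_gens.
split=> [su|[e0 el er ex]].
  have e0 j : (u even_pos)^`M(j) = - (sqrtC 2 *: mpoly_sign (u (left_pos j))).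
    have [/eqP + _ _] := act_X_NdE j u; rewrite su // ffunE eq_sym addr_eq0.
    by move=> /eqP/(congr1 (GRing.scale (sqrtC 2)));
      rewrite scalerA divff // scale1r scalerN.
  have el j k : (u (left_pos k))^`M(j) = 0.
    have [_ /(_ k)/eqP + _] := act_X_NdE j u; rewrite su // ffunE eq_sym.
    by rewrite scaler_eq0 invr_eq0 (negPf r0) => /eqP.
  have er j k : (u (right_pos k))^`M(j)
      = (k == j)%:R *: (sqrtC 2 *: mpoly_sign (u even_pos)).
    have [_ _ /(_ k)/eqP] := act_X_NdE j u; rewrite su // ffunE eq_sym subr_eq0.
    move=> /eqP/(congr1 (GRing.scale (sqrtC 2))).
    by rewrite !scalerA divff // scale1r mulrC.
  split=> [//|//|//|i j ij].
  (* For $\delta_i-\delta_j$, the left component at [i] reads $x_i\partial_jp_i+p_j=0$, where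
     $\partial_jp_i=0$; the right one at [j] reads $x_i\partial_jq_j-q_i=0$, where $\partial_jq_j$
     is known. *)
  have [_ El Er] := act_X_dNdE u (ltn_neq _ _ ij);
    move: (El i) (Er j) => {El Er} El Er.
  split.
    by move: El; rewrite su ?gdNd // ffunE el mulr0 eqxx scale1r add0r.
  move/eqP: Er; rewrite su ?gdNd // ffunE eq_sym er eqxx !scale1r subr_eq0.
  by rewrite scalerAr => /eqP.
(* Differentiating $\partial_jq_k$ once more brings in $\partial_iu_0$, hence $p_i$: the two parity
   signs and the two minus signs cancel, and the two factors $\sqrt2$ give 2. *)
have dd i j k : (u (right_pos k))^`M(j)^`M(i) = (2 * (k == j)%:R) *: u (left_pos
  i).
  rewrite er !mderivZ mderiv_sign e0 mpoly_signN mpoly_signZ mpoly_signK.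
  by rewrite opprK !scalerA -mulrA rr mulrC.
apply: nplus_ind => [|a X Y PX PY|j|j|i j ij|i j ij].
(* Linearity with coefficient $-1$ expresses the action of 0 as a vector minus itself. *)
- by have := act_linearl u (-1) 0 0; rewrite /= scaler0 addr0 scaleN1r addNr.
- by rewrite act_linearl PX PY scaler0 addr0.
- have [E0 El Er] := act_X_NdE j u; apply/ffunP; apply: posP => [|k|k].
  + by rewrite E0 e0 ffunE scalerN scalerA mulVf // scale1r addNr.
  + by rewrite El el ffunE scaler0.
  by rewrite Er er ffunE !scalerA mulrCA mulVf // mulr1 subrr.
- have [E0 El Er] := act_X_N2dE j u; apply/ffunP; apply: posP => [|k|k].
  + by rewrite E0 e0 ffunE mderivN mderivZ mderiv_sign el mpoly_sign0 oppr0
      scaler0 oppr0 scaler0.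
  + by rewrite El el mderiv0 ffunE scaler0.
  by rewrite Er dd ffunE scalerA mulNr mulrA half2 mul1r scaleNr addNr.
- have [E0 El Er] := act_X_dNdE u (ltn_neq _ _ ij); apply/ffunP.
  have [pj qi] := ex _ _ ij; apply: posP => [|k|k].
  + by rewrite E0 e0 pj mpoly_sign0 scaler0 oppr0 mulr0 ffunE.
  + by rewrite El el pj scaler0 mulr0 addr0 ffunE.
  by rewrite Er er qi ffunE -!scalerAr subrr.
have [E0 El Er] := act_X_NdNdE u (ltn_neq _ _ ij); apply/ffunP.
apply: posP => [|k|k].
- by rewrite E0 e0 ffunE mderivN mderivZ mderiv_sign el mpoly_sign0 oppr0
    scaler0 !oppr0.
- by rewrite El el mderiv0 ffunE oppr0.
(* After doubling, each of the last two terms is a mixed second derivative of $q_k$ by [dd]; since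
   derivatives commute, they cancel twice the first term. *)
rewrite Er ffunE; apply: (scalerI (_ : 2 != 0)); first by rewrite pnatr_eq0.
rewrite scaler0 scalerDr scalerDr !scalerA -!dd mderiv_comm.
by rewrite scalerN scaler_nat mulr2n addNr.
Qed.

End Act.

(** * The explicit solutions of the system *)

Section Solutions.
Context {C : numClosedFieldType} {m : nat}.
Local Notation n := m.+1.
Implicit Types (a c d : C) (k j : 'I_n).

(** The parameters are the constant terms of $u_0$, $p_1$ and $q_n$. The terms in $x_k$ and $x_k^2$
    integrate $\sqrt2\,s(u_0)=\sqrt2\,a+2c\,x_1$. Writing $n$ as [m.+1] provides [ord0] and
    [ord_max], which coincide when $n=1$. The constraint on [c] for larger $n$ is kept out of the
    formula so that it covers both cases. *)
Definition sing_vec a c d : tens C n :=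
  [ffun h => match split h with
    | inl _ => a *: 1 - (sqrtC 2 * c) *: 'X_ord0
    | inr h' => match split h' with
      | inl k => (c * (k == ord0)%:R) *: 1
      | inr k => (sqrtC 2 * a) *: 'X_k + (c * (k == ord0)%:R) *: 'X_k ^+ 2
                 + (d * (k == ord_max)%:R) *: 1
      end
    end].

Lemma sing_vecE a c d :
  [/\ sing_vec a c d even_pos = a *: 1 - (sqrtC 2 * c) *: 'X_ord0,
      forall k, sing_vec a c d (left_pos k) = (c * (k == ord0)%:R) *: 1
    & forall k, sing_vec a c d (right_pos k)
        = (sqrtC 2 * a) *: 'X_k + (c * (k == ord0)%:R) *: 'X_k ^+ 2
          + (d * (k == ord_max)%:R) *: 1].
Proof.
split=> [|k|k]; rewrite ffunE.
- by rewrite (unsplitK (inl _)).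
- by rewrite (unsplitK (inr _)) (unsplitK (inl _)).
by rewrite (unsplitK (inr _)) (unsplitK (inr _)).
Qed.

(** The term in [c] stands last because it is the one dropped when $n>1$. *)
Lemma sing_vecD a c d :
  sing_vec a c d
  = a *: sing_vec 1 0 0 + d *: sing_vec 0 0 1 + c *: sing_vec 0 1 0.
Proof.
apply/ffunP => h; rewrite !ffunE; case: (split h) => [_|h'].
  by rewrite !(mulr0, mulr1, scale0r, scaler0, addr0, subr0, sub0r, scale1r)
    scalerN scalerA mulrC.
case: (split h') => k; rewrite !(mul0r, mul1r, mulr0, mulr1, scale0r, scaler0,
  addr0, add0r, scale1r).
  by rewrite scalerA.
by rewrite !scalerA addrAC [a * _]mulrC.
Qed.

(** Each parameter is recovered as the constant coefficient of one component: $u_0$, $p_1$ and $q_n$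
    respectively. *)
Lemma sing_vec_eq0 a c d : sing_vec a c d = 0 -> [/\ a = 0, c = 0 & d = 0].
Proof.
move=> v0; have [E0 El Er] := sing_vecE a c d.
have X0 k : ('X_k : {mpoly C[n]})@_0%MM = 0.
  by rewrite mcoeffX; case: eqP => // /(congr1 (@mdeg n)); rewrite mdeg1 mdeg0.
split.
- have := congr1 (mcoeff 0%MM) E0; rewrite v0 ffunE mcoeff0 mcoeffB !mcoeffZ X0.
  by rewrite mcoeff1 eqxx mulr1 mulr0 subr0.
- have := congr1 (mcoeff 0%MM) (El ord0); rewrite v0 ffunE mcoeff0 mcoeffZ.
  by rewrite mcoeff1 !eqxx !mulr1.
have := congr1 (mcoeff 0%MM) (Er ord_max); rewrite v0 ffunE mcoeff0 !mcoeffD.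
rewrite !mcoeffZ rmorphXn /= X0 mcoeff1 !eqxx !mulr1 expr0n /= !mulr0 !add0r.
by [].
Qed.

Lemma singular_sing_vec a c d :
  ((0 < m)%N -> c = 0) -> singular (sing_vec a c d).
Proof.
move=> c0; have [E0 El Er] := sing_vecE a c d.
have rr : sqrtC 2 * sqrtC 2 = 2 :> C by rewrite -expr2 sqrtCK.
have s0 : mpoly_sign (sing_vec a c d even_pos) = a *: 1 + (sqrtC 2 * c) *:
  'X_ord0.
  rewrite E0 mpoly_signD mpoly_signN !mpoly_signZ mpoly_sign1 mpoly_signXU.
  by rewrite scalerN opprK.
have D1 j : (1 : {mpoly C[n]})^`M(j) = 0 by rewrite -mpolyC1 mderivC.
apply/singularP; split=> [j|j k|j k|i j ij].
- rewrite E0 El mderivB !mderivZ D1 scaler0 sub0r mderivXU mpoly_signZ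
    mpoly_sign1.
  by rewrite !scalerA mulrA eq_sym.
- by rewrite El mderivZ D1 scaler0.
- rewrite s0 Er !mderivD !mderivZ D1 scaler0 addr0 expr2 mderivM mderivXU.
  have [_|] := eqVneq k j; last by rewrite !scale0r mul0r mulr0 addr0 !scaler0
    addr0.
  rewrite !scale1r mulr1 mul1r !scalerDr !scalerA mulrA rr; congr (_ + _).
  (* For the first variable the derivative of $c\,x_1^2$ matches $2c\,x_1$; any other variable
     exists only if $n>1$, and then $c=0$. *)
  have [->|k0] := eqVneq k ord0; first by rewrite mulr1 -mulr2n -scaler_nat
    scalerA mulrC.
  rewrite c0 ?mul0r ?mulr0 ?scale0r ?addr0 //.
  by case: m k k0 => // -[[]].
(* Two distinct indices force $n>1$, hence $c=0$; and [i], being below [j], is not the last index,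
   so the [d] term is absent from $q_i$. *)
have m0 : (0 < m)%N := leq_ltn_trans (leq0n i) (leq_trans ij (leq_ord j)).
rewrite El Er s0 c0 // !mul0r mulr0 !scale0r !addr0; split=> //.
rewrite -scalerAr mulr1 scalerA (_ : i == ord_max = false) ?mulr0 ?scale0r
  ?addr0 //.
by apply/eqP => im; rewrite im ltnNge -ltnS ltn_ord in ij.
Qed.

Lemma singular_is_sing_vec u : singular u ->
  exists a c d, ((0 < m)%N -> c = 0) /\ u = sing_vec a c d.
Proof.
move=> /singularP[e0 el er ex].
have rr : sqrtC 2 * sqrtC 2 = 2 :> C by rewrite -expr2 sqrtCK.
have D1 j : (1 : {mpoly C[n]})^`M(j) = 0 by rewrite -mpolyC1 mderivC.
pose c := (u (left_pos ord0))@_0%MM.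
have pE k : u (left_pos k) = (c * (k == ord0)%:R) *: 1.
  have [->|k0] := eqVneq k ord0; first by rewrite mulr1; exact: mpoly_const.
  have [|-> _] := ex ord0 k; first by rewrite lt0n -[0%N]/(val (@ord0 m))
    val_eqE.
  by rewrite mulr0 scale0r.
have [a u0E] : exists a, u even_pos = a *: 1 - (sqrtC 2 * c) *: 'X_ord0.
  (* By the first equation all derivatives of this polynomial vanish, so it is the constant [a]. *)
  pose f := u even_pos + (sqrtC 2 * c) *: 'X_ord0; exists f@_0%MM.
  rewrite -mpoly_const ?addrK // => j; rewrite mderivD e0 pE mderivZ mderivXU.
  by rewrite mpoly_signZ mpoly_sign1 !scalerA mulrA eq_sym addNr.
have s0 : mpoly_sign (u even_pos) = a *: 1 + (sqrtC 2 * c) *: 'X_ord0.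
  rewrite u0E mpoly_signD mpoly_signN !mpoly_signZ mpoly_sign1 mpoly_signXU.
  by rewrite scalerN opprK.
have c0 : (0 < m)%N -> c = 0.
  move=> m0; have := mderiv_comm ord0 ord_max (u (right_pos ord_max)).
  have nm0 : (@ord_max m == ord0) = false by rewrite -val_eqE -[val ord_max]/m;
    case: (m) m0.
  rewrite !er nm0 eqxx scale0r scale1r mderiv0 mderivZ s0 mderivD !mderivZ D1.
  rewrite mderivXU eqxx scale1r scaler0 add0r !scalerA mulrA rr.
  move/(congr1 (mcoeff 0%MM))/eqP; rewrite mcoeff0 mcoeffZ mcoeff1 eqxx mulr1.
  by rewrite eq_sym mulf_eq0 pnatr_eq0 => /eqP.
(* What is left of $q_n$ after removing its expected nonconstant terms; it is shown below to have
   zero derivatives, so its constant coefficient is [d]. *)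
pose f := u (right_pos ord_max) - ((sqrtC 2 * a) *: 'X_ord_max
  + (c * (@ord_max m == ord0)%:R) *: 'X_ord_max ^+ 2).
exists a, c, f@_0%MM; split=> //; have [E0 El Er] := sing_vecE a c f@_0%MM.
apply/ffunP; apply: posP => [|k|k]; first by rewrite E0.
  by rewrite El.
rewrite Er; have [->|km] := eqVneq k ord_max; last first.
  (* Below the last index, the equations of $\delta_k-\delta_n$ give $q_k$ outright, with no
     constant of integration. *)
  have ltk : (k < @ord_max m)%N by rewrite ltn_neqAle km -ltnS ltn_ord.
  have [_ ->] := ex _ _ ltk; rewrite s0 c0; last exact: leq_ltn_trans ltk.
  by rewrite !(mulr0, mul0r, scale0r, addr0) -scalerAr mulr1 scalerA.
rewrite mulr1 -mpoly_const => [|j]; first by rewrite /f addrC subrK.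
rewrite mderivB er mderivD !mderivZ expr2 mderivM mderivXU s0.
have [_|] := eqVneq ord_max j; last by rewrite !scale0r mul0r mulr0 addr0
  !scaler0 addr0 subrr.
rewrite !scale1r mulr1 mul1r scalerDr !scalerA mulrA rr.
(* If $n=1$ the quadratic term supplies $2c\,x_1$; otherwise it is absent and $c=0$. *)
have [->|nm0] := eqVneq ord_max ord0.
  by rewrite mulr1 -mulr2n -scaler_nat scalerA [c * _]mulrC subrr.
rewrite c0; first by rewrite !(mulr0, mul0r, scale0r, addr0) subrr.
by case: (m) nm0 => //; rewrite -val_eqE.
Qed.

End Solutions.

(** * Counting the free parameters *)

Theorem proposition1p1 (R : realType) (n : nat) (hn : (1 <= n)%N) :
  has_dim (fun u : tens R[i] n => singular u) (if n == 1%N then 3%N else 2%N).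
Proof.
case: n hn => // m _.
(* The basis vectors are made opaque, keeping only their combination rule, bracketed as the sum over
   three indices unfolds. *)
have [A [D [B vE]]] : exists A D B : tens R[i] m.+1,
    forall a c d, a *: A + (d *: D + c *: B) = sing_vec a c d.
  exists (sing_vec 1 0 0), (sing_vec 0 0 1), (sing_vec 0 1 0) => a c d.
  by rewrite addrA -sing_vecD.
case: m A D B vE => [|m] A D B vE.
  (* Here $n=1$, so the condition on [c] is vacuous and all three parameters are free. *)
  exists (fun i => [:: A; D; B]`_i); split=> [x|u].
    rewrite !big_ord_recl big_ord0 addr0 vE.
    case/sing_vec_eq0 => x0 x2 x1 [[|[|[|//]]] p].
    - by rewrite -[RHS]x0; congr x; apply: val_inj.
    - by rewrite -[RHS]x1; congr x; apply: val_inj.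
    by rewrite -[RHS]x2; congr x; apply: val_inj.
  split=> [/singular_is_sing_vec[a [c [d [_ ->]]]]|[x ->]].
    exists (fun i : 'I_3 => [:: a; d; c]`_i).
    by rewrite !big_ord_recl big_ord0 addr0 vE.
  rewrite !big_ord_recl big_ord0 addr0 vE.
  exact: singular_sing_vec.
(* From here on $n>1$: [c] must vanish, which leaves the span of [A] and [D]. *)
have v0E a d : a *: A + d *: D = sing_vec a 0 d.
  by rewrite -vE scale0r addr0.
exists (fun i => [:: A; D]`_i); split=> [x|u].
  rewrite !big_ord_recl big_ord0 addr0 v0E.
  case/sing_vec_eq0 => x0 _ x1 [[|[|//]] p].
  - by rewrite -[RHS]x0; congr x; apply: val_inj.
  by rewrite -[RHS]x1; congr x; apply: val_inj.
split=> [/singular_is_sing_vec[a [c [d [c0 ->]]]]|[x ->]].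
  exists (fun i : 'I_2 => [:: a; d]`_i).
  by rewrite !big_ord_recl big_ord0 addr0 v0E c0.
rewrite !big_ord_recl big_ord0 addr0 v0E.
exact: singular_sing_vec.
Qed.
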